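(* Let $n\ge 1$ be an integer. For every $k=1,\ldots,n-1$, one has $Z_k=O_k$, where $$O_k=\left\{\gamma\in\mathbb{C}^n : \operatorname{ord}D(\gamma)\ge n-k\right\}.$$ Equivalently, for every $k=1,\ldots,n-1$, $$Z_k=V\left(\{\partial_\delta D : \delta\in\mathbb{N}^n,\ |\delta|\le n-k-1\}\right).$$ Hence $Z_{n-1}\supsetneq Z_{n-2}\supsetneq\cdots\supsetneq Z_1$ is the order-based stratification of the discriminant hypersurface $Z_{n-1}=V(D)$ (that is, the chain is strictly decreasing and its members are the sets $O_{n-1},O_{n-2},\ldots,O_1$ defined by the order of $D$).
   Context: Let $F=x^n+a_{n-1}x^{n-1}+\cdots+a_1x+a_0$ be the general monic univariate polynomial of degree $n$, with indeterminate coefficients $a_0,\ldots,a_{n-1}$, and let $D\in\mathbb{C}[a_0,\ldots,a_{n-1}]$ be its discriminant with respect to $x$, i.e. $D=(-1)^{n(n-1)/2}\operatorname{res}_x(F,F')$ with $F'=\partial F/\partial x$. A point $\gamma=(\gamma_0,\ldots,\gamma_{n-1})\in\mathbb{C}^n$ is identified with the polynomial $F_\gamma=x^n+\gamma_{n-1}x^{n-1}+\cdots+\gamma_0$. For an integer $k\ge 0$, $$Z_k=\{\gamma\in\mathbb{C}^n : F_\gamma \text{ has at most } k \text{ distinct complex roots}\}.$$ For a set $S\subseteq\mathbb{C}[a_0,\ldots,a_{n-1}]$, $V(S)\subseteq\mathbb{C}^n$ denotes its common zero set. For $\delta=(\delta_0,\ldots,\delta_{n-1})\in\mathbb{N}^n$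 (with $0\in\mathbb{N}$), $|\delta|=\delta_0+\cdots+\delta_{n-1}$ and $\partial_\delta D=\dfrac{\partial^{|\delta|}D}{\partial a_0^{\delta_0}\cdots\partial a_{n-1}^{\delta_{n-1}}}$. The order $\operatorname{ord}D(\gamma)$ of $D$ at $\gamma$ is the smallest total degree of a nonzero term in the Taylor expansion of $D$ around $\gamma$, i.e. the smallest $|\delta|$ with $(\partial_\delta D)(\gamma)\neq 0$. *)

(* Defs.v *)
From HB Require Import structures.
From mathcomp Require Import all_boot all_order all_algebra.
From mathcomp Require Import boolp classical_sets cardinality reals.
From mathcomp Require Import complex mpoly.

Set Implicit Arguments.
Unset Strict Implicit.
Unset Printing Implicit Defensive.

Import GRing.Theory.

Local Open Scope ring_scope.
Local Open Scope classical_set_scope.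
Local Open Scope card_scope.

Definition monic_poly_of (A : comNzRingType) (n : nat) (c : 'I_n -> A) :
    {poly A} :=
  'X^n + \sum_(i < n) (c i)%:P * 'X^i.

Definition general_poly (K : comNzRingType) (n : nat) : {poly {mpoly K[n]}} :=
  monic_poly_of (fun i : 'I_n => 'X_i).

(* The Sylvester matrix of the library lists coefficients by increasing degree;
   this changes the classical resultant of polynomials of degrees n and n - 1
   by the factor (-1)^(n(n-1)) = 1 only. *)
Definition discr (K : comNzRingType) (n : nat) : {mpoly K[n]} :=
  (-1) ^+ (n * n.-1)./2
    * resultant (general_poly K n) (general_poly K n)^`().

Definition Zk (K : comNzRingType) (n k : nat) : set ('I_n -> K) :=
  [set g | [set x : K | root (monic_poly_of g) x] #<= `I_k].

Definition zero_locus (K : comNzRingType) (n : nat) (S : set {mpoly K[n]}) :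
    set ('I_n -> K) :=
  [set g | forall p, S p -> p.@[g] = 0].

Definition nonzero_deriv_of_degree (K : comNzRingType) (n : nat)
    (p : {mpoly K[n]}) (g : 'I_n -> K) (d : nat) : Prop :=
  exists2 delta : 'X_{1..n}, mdeg delta = d & (p^`M[delta]).@[g] != 0.

(* [None] stands for the order +oo, i.e. for the case where every partial
   derivative of p vanishes at g. *)
Definition ord (K : comNzRingType) (n : nat) (p : {mpoly K[n]})
    (g : 'I_n -> K) : option nat :=
  match pselect (exists d, `[< nonzero_deriv_of_degree p g d >]) with
  | left ex_d => Some (ex_minn ex_d)
  | right _ => None
  end.

Definition ord_ge (o : option nat) (m : nat) : Prop :=
  if o is Some d then (m <= d)%N else True.

Definition Ok (K : comNzRingType) (n k : nat) : set ('I_n -> K) :=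
  [set g | ord_ge (ord (discr K n) g) (n - k)].

Arguments Zk : clear implicits.
Arguments Ok : clear implicits.

(* Main.v *)
Require Import Defs.
From HB Require Import structures.
From mathcomp Require Import all_boot all_order all_algebra.
From mathcomp Require Import boolp classical_sets cardinality reals.
From mathcomp Require Import zify perm complex mpoly.

Set Implicit Arguments.
Unset Strict Implicit.
Unset Printing Implicit Defensive.

Import Order.TTheory GRing.Theory Num.Theory.

Local Open Scope ring_scope.
Local Open Scope classical_set_scope.
Local Open Scope card_scope.

(** Everything follows from one equality: if the monic polynomial [F] of degree
    [n] with coefficient vector [g] has [r] distinct roots, then the order of
    the discriminant [D] at [g] is exactly [n - r].

    Let [ws] be the list of the [n - 1] roots of [F'] with multiplicity, and let
    [e] be the number of entries of [ws] that are also roots of [F]. A root of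
    [F] of multiplicity [m] has multiplicity [m - 1] in [F'], so [e = n - r]
    ([count_common_roots]).

    Lower bound, [ord D >= e] ([vanishes_discr]). The product [h] of the ['X - w]
    over these [e] entries divides both [F] and [F'], so the rows of their
    Sylvester matrix are coefficient vectors of multiples of [h], and the matrix
    has corank at least [e] ([rank_common_divisor]). The determinant of a matrix
    of polynomials vanishes to order at least [c] at a point where the corank of
    the matrix is at least [c]: after constant row operations, [c] rows vanish
    at the point ([vanishes_det]).

    Upper bound, [ord D <= e] ([vanishes_discr_iff]). Restrict [D] to the line
    [F + t] obtained by moving the constant coefficient. The restriction [P] is,
    up to sign, the resultant of [F + t] and [F'], where only the [n - 1] rows
    of [F + t] involve [t], so [P] has degree at most [n - 1]; it is nonzero,
    because [F + t] and [F'] are coprime for general [t]. By the lower bound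
    applied at each [F + t], the multiplicity of [t] as a root of [P] is at least
    the number of [w] in [ws] with [- F(w) = t]. These numbers add up to [n - 1],
    so that each of the inequalities is an equality ([mup_on_line_discr]). At
    [t = 0] this says that [P] vanishes to order exactly [e] at [0], and the
    order of [D] at [g] cannot exceed the order of its restriction to a line
    through [g] ([vanishes_on_line]).

    The strictness of the chain is witnessed by the polynomials with roots
    [0, ..., k - 1], the root [0] being repeated [n - k + 1] times
    ([exists_card_roots]). *)

(** * Multiplicities of roots *)

(** Writing [p = q * ('X - x) ^+ m.+1] with [q.[x] != 0], the cofactor of
    [('X - x) ^+ m] in [p'] takes at [x] the value [m.+1 * q.[x]], which is
    nonzero in characteristic zero. *)
Lemma mup_deriv (K : numFieldType) (p : {poly K}) (x : K) :
  p != 0 -> root p x -> mup x p = (mup x p^`()).+1.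
Proof.
move=> p0 rpx; have [m [q]] := multiplicity_XsubC p x.
rewrite p0 /= => qx Dp; case: m Dp => [|m] Dp.
  by rewrite Dp expr0 mulr1 (negPf qx) in rpx.
rewrite {1}Dp mupMr // mup_XsubCX eqxx.
have -> : p^`() = (q^`() * ('X - x%:P) + q *+ m.+1) * ('X - x%:P) ^+ m.
  rewrite Dp derivM deriv_exp derivXsubC mul1r /= mulrDl -mulrA -exprS.
  by rewrite mulrnAr mulrnAl.
rewrite mupMr ?mup_XsubCX ?eqxx //.
rewrite rootE !(hornerE, hornerMn) subrr mulr0 add0r.
by rewrite mulrn_eq0.
Qed.

Lemma mup_scale_prod_XsubC (K : fieldType) (c x : K) (s : seq K) : c != 0 ->
  mup x (c *: \prod_(z <- s) ('X - z%:P)) = count_mem x s.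
Proof.
by move=> c0; rewrite -mul_polyC mupMr ?mu_prod_XsubC ?rootC.
Qed.

Lemma perm_cat_of_count_le (T : eqType) (s t : seq T) :
  (forall x, (count_mem x s <= count_mem x t)%N) ->
  exists u, perm_eq t (s ++ u).
Proof.
move/count_subseqP => [s' /perm_to_subseq[u pu] ps].
by exists u; rewrite (perm_trans pu) // perm_cat2r perm_sym.
Qed.

Lemma count_undup_sum (T : eqType) (s t : seq T) :
  count (mem t) s = \sum_(x <- undup t) count_mem x s.
Proof.
elim: s => [|y s IHs] /=; first by rewrite big1_eq.
rewrite big_split /= IHs; congr (_ + _)%N.
under eq_bigr => x _ do rewrite eq_sym.
rewrite -(mem_undup t y).
have := count_uniq_mem y (undup_uniq t); rewrite -big_mkcond /= sum1_count.
by move<-.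
Qed.

Lemma card_mem_seq (T : eqType) (s : seq T) : uniq s ->
  [set x | x \in s] #= `I_(size s).
Proof.
case: s => [_|x0 s' us].
  by rewrite (_ : [set x | _] = set0) ?II0 //; apply/seteqP; split.
set s := x0 :: s' in us *.
have -> : [set x | x \in s] = nth x0 s @` `I_(size s).
  apply/seteqP; split=> [x /= xs|_ [i ? <-]]; last exact: mem_nth.
  by exists (index x s); [rewrite -index_mem in xs|rewrite nth_index].
apply: inj_card_eq => i j; rewrite !inE /= => li lj /eqP.
by rewrite nth_uniq // => /eqP.
Qed.

(** * Order of vanishing of a multivariate polynomial *)

Section Vanish.
Context (K : comNzRingType) (n : nat).
Implicit Types (p q : {mpoly K[n]}) (g : 'I_n -> K).

(** The inequality [d <= ord p g], stated without the minimum, so that the case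
    of infinite order needs no separate treatment. *)
Definition vanishes (d : nat) g p :=
  forall m : 'X_{1..n}, (mdeg m < d)%N -> (p^`M[m]).@[g] = 0.

(** Iterated partial derivatives commute, so [vanishes] obeys the recursion on
    first derivatives from which all the inductions below start. *)
Lemma vanishesS d g p :
  vanishes d.+1 g p <-> p.@[g] = 0 /\ forall i, vanishes d g p^`M(i).
Proof.
split=> [Vp|[p0 Vp] m].
  split=> [|i m dm]; first by rewrite -[p]mderivm0m Vp ?mdeg0.
  by rewrite -mderivmU1m -mderivmDm Vp // mdegD mdeg1.
have [->|m0] := eqVneq m 0%MM; first by rewrite mderivm0m.
have [i mi] : exists i, m i != 0%N.
  apply/existsP; apply: contraNT m0; rewrite negb_exists => /forallP m0.
  by apply/eqP/mnmP=> i; rewrite mnm0E; apply/eqP; have := m0 i; rewrite negbK.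
have -> : m = (U_(i) + (m - U_(i)))%MM.
  by rewrite addmC submK // lep1mP.
by rewrite mdegD mdeg1 mderivmDm mderivmU1m; apply: Vp.
Qed.

Lemma vanishes_leq d e g p : (e <= d)%N -> vanishes d g p -> vanishes e g p.
Proof. by move=> le_ed Vp m dm; apply: Vp; apply: leq_trans le_ed. Qed.

Lemma vanishesD d g p q :
  vanishes d g p -> vanishes d g q -> vanishes d g (p + q).
Proof. by move=> Vp Vq m dm; rewrite mderivmD mevalD Vp ?Vq ?addr0. Qed.

Lemma vanishes0 d g : vanishes d g 0.
Proof. by move=> m _; rewrite raddf0 meval0. Qed.

(** Leibniz rule: each term of a first derivative of [p * q] loses one order in
    only one of the two factors, and the induction is on the total order. *)
Lemma vanishesM d e g p q :
  vanishes d g p -> vanishes e g q -> vanishes (d + e) g (p * q).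
Proof.
have [k] := ubnP (d + e)%N; elim: k d e p q => // k IHk d e p q.
rewrite ltnS => le_k Vp Vq; case Dc: (d + e)%N => [|c]; first by move=> m.
have lt_ck : (c < k)%N by rewrite -Dc.
apply/vanishesS; split=> [|i].
  rewrite mevalM; case: d {le_k} Dc Vp => [|d] Dc => [_|/vanishesS[-> _]].
    rewrite add0n in Dc; move: Vq; rewrite Dc => /vanishesS[-> _].
    by rewrite mulr0.
  by rewrite mul0r.
rewrite mderivM; apply: vanishesD.
  case: d {le_k} Dc Vp => [|d] Dc Vp.
    rewrite -[c]add0n; apply: IHk => //.
    by apply: vanishes_leq Vq; rewrite -[e]add0n Dc.
  move: Dc; rewrite addSn => -[Dc]; rewrite -Dc.
  apply: IHk => //; rewrite ?Dc //.
  by have [_] := (vanishesS _ _ _).1 Vp; apply.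
case: e {le_k} Dc Vq => [|e] Dc Vq.
  rewrite -[c]addn0; apply: IHk => //; rewrite ?addn0 //.
  by apply: vanishes_leq Vp; rewrite -[d]addn0 Dc.
move: Dc; rewrite addnS => -[Dc]; rewrite -Dc.
apply: IHk => //; rewrite ?Dc //.
by have [_] := (vanishesS _ _ _).1 Vq; apply.
Qed.

Lemma vanishes_prod (I : Type) (r : seq I) (d : I -> nat)
    (F : I -> {mpoly K[n]}) g :
  (forall i, vanishes (d i) g (F i)) ->
  vanishes (\sum_(i <- r) d i) g (\prod_(i <- r) F i).
Proof.
move=> VF; elim: r => [|i r IHr]; first by rewrite !big_nil => m.
by rewrite !big_cons; apply: vanishesM.
Qed.

Lemma vanishes_sum (I : Type) (r : seq I) d (F : I -> {mpoly K[n]}) g :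
  (forall i, vanishes d g (F i)) ->
  vanishes d g (\sum_(i <- r) F i).
Proof.
move=> VF; elim: r => [|i r IHr]; first by rewrite big_nil; apply: vanishes0.
by rewrite big_cons; apply: vanishesD.
Qed.

Lemma vanishesMl d g p q : vanishes d g q -> vanishes d g (p * q).
Proof. by move=> Vq; rewrite -[d]add0n; apply: vanishesM. Qed.
End Vanish.

Lemma ord_ge_vanishes (K : comNzRingType) n (p : {mpoly K[n]})
    (g : 'I_n -> K) m :
  ord_ge (ord p g) m <-> vanishes m g p.
Proof.
rewrite /ord; case: pselect => [ex_d|no_d] /=; last first.
  split=> // _ delta _; apply/eqP; apply: contra_notT no_d => nz.
  by exists (mdeg delta); apply/asboolP; exists delta.
case: ex_minnP => d /asboolP[delta deg_delta nz] min_d.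
split=> [le_md eps lt_eps|Vm].
  apply/eqP; apply: contraTT (leq_trans lt_eps le_md) => nz_eps.
  by rewrite -leqNgt; apply: min_d; apply/asboolP; exists eps.
rewrite leqNgt; apply: contraNN nz => lt_dm.
by rewrite Vm ?deg_delta.
Qed.

(** * Determinants of polynomial matrices *)

Lemma leq_add_count_ord (N r : nat) : (N <= r + \sum_(i < N) (r <= i))%N.
Proof.
elim: N => [|N IHN]; first by rewrite leq0n.
rewrite big_ord_recr /= addnA; case: (leqP r N) => [_|lt_Nr].
  by rewrite /= addn1 ltnS.
by rewrite /= addn0 (leq_trans lt_Nr) ?leq_addr.
Qed.

(** A determinant vanishes at [g] at least to the order given by the corank of
    the matrix at [g]: constant row operations make all but [\rank] rows vanish
    at [g], and each term of the Leibniz expansion has a factor in each row. *)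
Lemma vanishes_det (K : fieldType) (n N c : nat) (M : 'M[{mpoly K[n]}]_N)
    (g : 'I_n -> K) :
  (\rank (map_mx (meval g) M) + c <= N)%N -> vanishes c g (\det M).
Proof.
set M0 := map_mx _ _ => le_rcN; pose r := \rank M0.
pose cst := map_mx (@mpolyC n K).
(* Constant row operations kill the last N - r rows of the value of M at g. *)
pose M1 := cst _ _ (invmx (col_ebase M0)) *m M.
have -> : \det M = \det (cst _ _ (col_ebase M0)) * \det M1.
  rewrite -det_mulmx mulmxA /cst -map_mxM /= mulmxV ?col_ebase_unit //.
  by rewrite map_mx1 mul1mx.
apply: vanishesMl; apply: vanishes_sum => s; apply: vanishesMl.
have row0 (i j : 'I_N) : vanishes (r <= i)%N g (M1 i j).
  have [le_ri|//] := leqP r i.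
  apply/vanishesS; split=> [|//].
  have -> : (M1 i j).@[g] = (invmx (col_ebase M0) *m M0) i j.
    rewrite mxE raddf_sum [RHS]mxE; apply: eq_bigr => k _ /=.
    by rewrite !mxE [meval g _]mevalM mevalC.
  rewrite -{2}[M0]mulmx_ebase !mulmxA mulVmx ?col_ebase_unit // mul1mx.
  rewrite mxE big1 // => k _; rewrite mxE /=.
  by rewrite ltnNge le_ri andbF mul0r.
(* Each Leibniz term has one factor in each of the last N - r rows. *)
apply: (@vanishes_leq _ _ (\sum_(i < N) (r <= i))%N); last first.
  exact: (vanishes_prod (fun i => row0 i (s i))).
rewrite -(leq_add2l r) (leq_trans le_rcN) //.
exact: leq_add_count_ord.
Qed.

Lemma size_det_leq (A : nzRingType) N (M : 'M[{poly A}]_N) (d : 'I_N -> nat) :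
  (forall i j, (size (M i j) <= (d i).+1)%N) ->
  (size (\det M) <= (\sum_i d i).+1)%N.
Proof.
move=> dM; apply: leq_trans (size_sum _ _ _) _; apply/bigmax_leqP => s _.
rewrite size_Msign.
elim/big_rec2: _ => [|i y x _ IH]; first by rewrite size_poly1.
apply: leq_trans (size_polyMleq _ _) _.
by have := leq_add (dM i (s i)) IH; rewrite addnS addSn; case: (_ + size _)%N.
Qed.

(** * Resultants *)

(** The polynomials of size at most [N] that are multiples of [h] form a space
    of dimension [N - (size h).-1]: the matrix factors through the coordinates
    of the quotients by [h]. *)
Lemma rank_common_divisor (K : fieldType) (N : nat) (P : 'I_N -> {poly K})
    (h : {poly K}) :
  h != 0 -> (forall i, (size (P i) <= N)%N) -> (forall i, h %| P i) ->
  (\rank (\matrix_(i < N, j < N) (P i)`_j : 'M[K]_N)%R <= N - (size h).-1)%N.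
Proof.
move=> h0 szP hP; set k := (N - _)%N.
pose A := \matrix_(i < N, l < k) (P i %/ h)`_l.
pose B := \matrix_(l < k, j < N) (h * 'X^l)`_j.
suff -> : \matrix_(i < N, j < N) (P i)`_j = A *m B by apply: mulmx_max_rank.
apply/matrixP=> i j; rewrite !mxE.
have szQ : (size (P i %/ h)%R <= k)%N by rewrite size_divp // leq_sub2r.
set Q := (P i %/ h)%R in szQ *.
transitivity (\sum_(l < size Q) Q`_l * (h * 'X^l)`_j).
  rewrite -{1}(divpK (hP i)) -/Q -{1}[Q]coefK poly_def mulr_suml coef_sum.
  by apply: eq_bigr => l _; rewrite -scalerAl coefZ [h * _]mulrC.
rewrite (big_ord_widen k (fun l => Q`_l * (h * 'X^l)`_j)) // big_mkcond /=.
apply: eq_bigr => l _; rewrite !mxE.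
by case: ltnP => // le_l; rewrite nth_default ?mul0r.
Qed.

Lemma Sylvester_coef (A : nzRingType) (p q : {poly A}) i j :
  Sylvester_mx p q i j =
    match split i with inl k => (p * 'X^k)`_j | inr k => (q * 'X^k)`_j end.
Proof.
rewrite Sylvester_mxE; case: (split i) => k; rewrite coefMXn ltnNge.
  by case: leqP.
by case: leqP.
Qed.

(** The specialisation at [g] may lower the degrees of [p] and [q], so the matrix
    considered is the value at [g] of the Sylvester matrix of [p] and [q], and
    not the Sylvester matrix of the specialised polynomials. *)
Lemma vanishes_resultant (K : fieldType) (n : nat) (g : 'I_n -> K)
    (p q : {poly {mpoly K[n]}}) (h : {poly K}) :
  map_poly (meval g) q != 0 -> h %| map_poly (meval g) p ->
  h %| map_poly (meval g) q ->
  vanishes (size h).-1 g (resultant p q).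
Proof.
set ev := map_poly _ => q0 hp hq.
have h0 : h != 0 by apply: contraNneq q0 => h0; rewrite h0 dvd0p in hq.
have szev (f : {poly {mpoly K[n]}}) : (size (ev f) <= size f)%N.
  exact: size_poly.
apply: vanishes_det.
have le_hq : ((size h).-1 <= (size q).-1)%N.
  by rewrite -!subn1 leq_sub2r // (leq_trans (dvdp_leq q0 hq)).
set N := ((size q).-1 + (size p).-1)%N.
pose P (i : 'I_N) :=
  match split i with inl k => ev p * 'X^k | inr k => ev q * 'X^k end.
have -> : map_mx (meval g) (Sylvester_mx p q) = \matrix_(i < N, j < N) (P i)`_j.
  apply/matrixP=> i j; rewrite mxE Sylvester_coef [RHS]mxE /P.
  case: (split i) => k; rewrite !coefMXn; case: ifP; rewrite ?meval0 //.
    by rewrite coef_map.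
  by rewrite coef_map.
apply: (@leq_trans (N - (size h).-1 + (size h).-1)).
  rewrite leq_add2r; apply: rank_common_divisor => // i; rewrite /P; last first.
    by case: (split i) => k; apply: dvdp_mulr.
  have le_shift (f : {poly {mpoly K[n]}}) k m : (k < m)%N ->
      (size (ev f * 'X^k)%R <= m + (size f).-1)%N.
    move=> lt_km; apply: leq_trans (size_polyMleq _ _) _.
    rewrite size_polyXn addnS /= addnC.
    apply: leq_trans (leq_add (leqnn k) (leq_trans (szev f) (leqSpred _))) _.
    by rewrite addnS -addSn leq_add2r.
  case: (split i) => k; first exact: le_shift.
  by rewrite /N addnC; apply: le_shift.
by rewrite subnK // (leq_trans le_hq) ?leq_addr.
Qed.

(** Only the [(size q).-1] rows that come from [p] depend on the variable of the
    coefficients, and they do so with degree at most one. *)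
Lemma size_resultant_leq (A : nzRingType) (p q : {poly {poly A}}) :
  (forall i, (size (p`_i)%R <= 2)%N) -> (forall i, (size (q`_i)%R <= 1)%N) ->
  (size (resultant p q) <= (size q).-1.+1)%N.
Proof.
move=> szp szq.
pose d (i : 'I_((size q).-1 + (size p).-1)) : nat :=
  if split i is inl _ then 1%N else 0%N.
apply: leq_trans (@size_det_leq _ _ _ d _) _.
  move=> i j; rewrite Sylvester_coef /d; case: (split i) => k; rewrite coefMXn;
  by case: ifP; rewrite ?size_poly0 ?szp ?szq.
rewrite ltnS big_split_ord /=.
rewrite [X in (_ + X)%N]big1 ?addn0; last first.
  by move=> i _; rewrite /d; case: split_ordP => // k /eqP; rewrite eq_rlshift.
rewrite -[leqRHS]muln1 -[X in (X * 1)%N]card_ord -sum_nat_const.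
by apply: leq_sum => i _; rewrite /d; case: (split _).
Qed.

Lemma rmorph_resultant (A B : nzRingType) (f : {rmorphism A -> B})
    (p q : {poly A}) :
  f (lead_coef p) != 0 -> f (lead_coef q) != 0 ->
  f (resultant p q) = resultant (map_poly f p) (map_poly f q).
Proof.
move=> fp fq; rewrite -det_map_mx /resultant /Sylvester_mx.
rewrite !size_map_poly_id0 // map_col_mx; congr (\det (col_mx _ _));
  by apply: map_lin1_mx => v; rewrite map_poly_rV rmorphM /= map_rVpoly.
Qed.

(** * Restriction to a line parallel to a coordinate axis *)

Section Line.
Context (K : numFieldType) (n : nat).
Implicit Types (p q : {mpoly K[n]}) (g : 'I_n -> K).

(** The generic point of the line: its points [line g i0 t] are obtained by
    giving the value [t] to ['X]. *)
Definition line_pt g (i0 : 'I_n) (i : 'I_n) : {poly K} :=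
  (g i)%:P + (if i == i0 then 'X else 0).

Definition line g i0 (t : K) (i : 'I_n) : K :=
  g i + (if i == i0 then t else 0).

Definition on_line g i0 (p : {mpoly K[n]}) : {poly K} :=
  mmap (@polyC K) (line_pt g i0) p.

Lemma horner_on_line g i0 p t : (on_line g i0 p).[t] = p.@[line g i0 t].
Proof.
rewrite /on_line /meval /mmap horner_sum; apply: eq_bigr => m _.
rewrite hornerM hornerC; congr (_ * _).
rewrite /mmap1 horner_prod; apply: eq_bigr => i _.
rewrite horner_exp /line_pt /line hornerD hornerC.
by case: ifP; rewrite ?hornerX ?horner0.
Qed.

HB.instance Definition _ g i0 := GRing.RMorphism.copy (on_line g i0)
  (mmap (@polyC K) (line_pt g i0)).

Lemma on_lineC g i0 c : on_line g i0 c%:MP = c%:P.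
Proof. exact: mmapC. Qed.

Lemma on_lineX g i0 i : on_line g i0 'X_i = line_pt g i0 i.
Proof. by rewrite /on_line mmapX mmap1U. Qed.

(** Chain rule. Both sides are derivations along the restriction morphism, so
    they agree as soon as they agree on constants and on the variables. *)
Lemma deriv_on_line g i0 p : (on_line g i0 p)^`() = on_line g i0 (p^`M(i0)).
Proof.
pose good p := (on_line g i0 p)^`() = on_line g i0 (p^`M(i0)).
have goodM (p1 p2 : {mpoly K[n]}) : good p1 -> good p2 -> good (p1 * p2).
  rewrite /good (rmorphM (on_line g i0)) derivM mderivM => -> ->.
  by rewrite (rmorphD (on_line g i0)) !(rmorphM (on_line g i0)).
have goodC c : good c%:MP by rewrite /good mderivC on_lineC raddf0 derivC.
have goodX (i : 'I_n) : good 'X_i.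
  rewrite /good on_lineX /line_pt derivD derivC add0r mderivX mnm1E -mul_mpolyC.
  case: eqVneq => [->|_]; last by rewrite mpolyC0 mul0r !raddf0.
  have -> : (U_(i0) - U_(i0) = 0)%MM.
    by apply/mnmP => j; rewrite mnmBE subnn mnm0E.
  by rewrite mpolyX0 mulr1 on_lineC derivX.
elim/mpolyind: p => [|c m p _ _ IH]; first by rewrite mderiv0 !raddf0.
rewrite rmorphD derivD IH mderivD rmorphD /=; congr (_ + _).
rewrite -/(good _) -mul_mpolyC mpolyXE_id; apply: (goodM) => //.
have good1 : good 1 by rewrite -mpolyC1.
apply: big_ind => // i _.
by elim: (m i) => [|k IHk]; rewrite ?expr0 // exprS; apply: (goodM).
Qed.

(** Restricting to a line cannot lower the order. By the chain rule, the
    derivative of the restriction vanishes to order [d - 1], and in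
    characteristic zero passing from the derivative back to a polynomial that
    vanishes at [t] raises the multiplicity by one. *)
Lemma vanishes_on_line g i0 p t d :
  vanishes d (line g i0 t) p -> ('X - t%:P) ^+ d %| on_line g i0 p.
Proof.
elim: d p => [|d IHd] p; first by rewrite dvd1p.
move=> /vanishesS[p0 Vp].
have [->|nz] := eqVneq (on_line g i0 p) 0; first by rewrite dvdp0.
have rt : root (on_line g i0 p) t by rewrite rootE horner_on_line p0.
rewrite -mup_geq // (mup_deriv nz rt) ltnS deriv_on_line.
have [d0|d0] := eqVneq (on_line g i0 p^`M(i0)) 0; last by rewrite mup_geq ?IHd.
(* A restriction with zero derivative is a constant, and its value at t is 0. *)
have sz1 : (size (on_line g i0 p) <= 1)%N.
  apply/leq_sizeP => -[|j] // _; apply/eqP.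
  have /eqP := congr1 (fun q : {poly K} => q`_j) d0.
  by rewrite -deriv_on_line coef_deriv coef0 mulrn_eq0.
move: nz; rewrite (size1_polyC sz1) polyC_eq0 => /negP[].
by move: rt; rewrite rootE {1}(size1_polyC sz1) hornerC.
Qed.
End Line.

(** * Monic polynomials and their discriminant *)

Section MonicPoly.
Context (A : comNzRingType) (n : nat).
Implicit Types (c : 'I_n -> A).

Lemma coef_monic_poly_of c j :
  (monic_poly_of c)`_j = if insub j is Some i then c i else (j == n)%:R.
Proof.
have -> : monic_poly_of c = 'X^n + rVpoly (\row_i c i).
  rewrite /monic_poly_of /rVpoly poly_def; congr (_ + _).
  by apply: eq_bigr => i _; rewrite valK mxE mul_polyC.
rewrite coefD coefXn coef_rVpoly.
case: insubP => [i _ <-|]; last by rewrite addr0.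
by rewrite mxE (ltn_eqF (ltn_ord i)) add0r.
Qed.

Lemma size_monic_poly_of c : size (monic_poly_of c) = n.+1.
Proof.
apply/eqP; rewrite eqn_leq; apply/andP; split.
  apply/leq_sizeP => j lt_nj; rewrite coef_monic_poly_of insubN ?gtn_eqF //.
  by rewrite -leqNgt ltnW.
rewrite ltnNge; apply/negP => /leq_sizeP/(_ n (leqnn n))/eqP.
by rewrite coef_monic_poly_of insubN ?ltnn // eqxx oner_eq0.
Qed.

Lemma lead_coef_monic_poly_of c : lead_coef (monic_poly_of c) = 1.
Proof.
rewrite lead_coefE size_monic_poly_of coef_monic_poly_of.
by rewrite insubN ?ltnn //= eqxx.
Qed.

Lemma size_deriv_monic_poly_of c : n%:R != 0 :> A ->
  size (monic_poly_of c)^`() = n.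
Proof.
move=> n0; apply/eqP; rewrite eqn_leq; apply/andP; split.
  rewrite -ltnS -(size_monic_poly_of c) lt_size_deriv //.
  by rewrite -size_poly_eq0 size_monic_poly_of.
have n1 : (0 < n)%N by rewrite lt0n; apply: contraNneq n0 => ->.
suff : (n.-1 < size (monic_poly_of c)^`())%N by rewrite prednK.
rewrite ltnNge; apply/negP => /leq_sizeP/(_ _ (leqnn _))/eqP.
rewrite coef_deriv prednK // coef_monic_poly_of insubN ?ltnn //= eqxx.
by rewrite (negPf n0).
Qed.

Lemma lead_coef_deriv_monic_poly_of c : n%:R != 0 :> A ->
  lead_coef (monic_poly_of c)^`() = n%:R.
Proof.
move=> n0; rewrite lead_coefE size_deriv_monic_poly_of // coef_deriv.
have n1 : (0 < n)%N by rewrite lt0n; apply: contraNneq n0 => ->.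
by rewrite prednK // coef_monic_poly_of insubN ?ltnn //= eqxx.
Qed.
End MonicPoly.

Lemma map_monic_poly_of (A B : comNzRingType) (f : {rmorphism A -> B}) n
    (c : 'I_n -> A) :
  map_poly f (monic_poly_of c) = monic_poly_of (f \o c).
Proof.
apply/polyP => j; rewrite coef_map !coef_monic_poly_of.
by case: insubP => //= _; rewrite rmorph_nat.
Qed.

Lemma monic_poly_of_coefs (A : comNzRingType) n (p : {poly A}) :
  p \is monic -> size p = n.+1 -> monic_poly_of (fun i : 'I_n => p`_i) = p.
Proof.
move=> /monicP mon_p szp; apply/polyP=> j; rewrite coef_monic_poly_of.
case: insubP => [i _ <- //|]; rewrite -leqNgt leq_eqVlt => /predU1P[<-|lt_nj].
  by rewrite eqxx -mon_p lead_coefE szp.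
by rewrite gtn_eqF // nth_default ?szp.
Qed.

(** The hypothesis says that the leading coefficient of the derivative survives
    in [B], so that the formation of the Sylvester matrix commutes with [f]. *)
Lemma map_discr (K : numFieldType) (B : comNzRingType) n
    (f : {rmorphism {mpoly K[n]} -> B}) : n%:R != 0 :> B ->
  let p := monic_poly_of (fun i : 'I_n => f 'X_i) in
  f (discr K n) = (-1) ^+ (n * n.-1)./2 * resultant p p^`().
Proof.
move=> n0 p; have n0' : n%:R != 0 :> {mpoly K[n]}.
  by apply: contraNneq n0 => e; rewrite -(rmorph_nat f) e rmorph0.
rewrite /discr rmorphM rmorph_sign rmorph_resultant.
- by rewrite -deriv_map map_monic_poly_of.
- by rewrite lead_coef_monic_poly_of rmorph1 oner_eq0.
by rewrite lead_coef_deriv_monic_poly_of // rmorph_nat.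
Qed.

(** * The order of the discriminant *)

Section Main.
Context (K : numClosedFieldType) (n : nat).
Context (n_gt0 : (0 < n)%N).
Let D := discr K n.
Implicit Types (g : 'I_n -> K).

Let n_neq0 : n%:R != 0 :> K. Proof. by rewrite pnatr_eq0 -lt0n. Qed.

Lemma monic_poly_of_roots g :
  {zs | monic_poly_of g = \prod_(z <- zs) ('X - z%:P)}.
Proof.
have [zs Dzs] := closed_field_poly_normal (monic_poly_of g).
by exists zs; rewrite {1}Dzs lead_coef_monic_poly_of scale1r.
Qed.

Lemma deriv_monic_poly_of_roots g :
  {ws | (monic_poly_of g)^`() = n%:R *: \prod_(w <- ws) ('X - w%:P)}.
Proof.
have [ws Dws] := closed_field_poly_normal (monic_poly_of g)^`().
by exists ws; rewrite {1}Dws lead_coef_deriv_monic_poly_of.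
Qed.

Lemma count_deriv_roots g zs ws x :
  monic_poly_of g = \prod_(z <- zs) ('X - z%:P) ->
  (monic_poly_of g)^`() = n%:R *: \prod_(w <- ws) ('X - w%:P) ->
  x \in zs -> count_mem x zs = (count_mem x ws).+1.
Proof.
move=> Dzs Dws xzs.
have rx : root (monic_poly_of g) x by rewrite Dzs root_prod_XsubC.
have F0 : monic_poly_of g != 0 by rewrite -size_poly_eq0 size_monic_poly_of.
have := mup_deriv F0 rx.
by rewrite Dws mup_scale_prod_XsubC // Dzs mu_prod_XsubC.
Qed.

(** A root of multiplicity [m] accounts for [m] of the [n] roots of the
    polynomial and for [m - 1] of the roots of its derivative. *)
Lemma count_common_roots g zs ws :
  monic_poly_of g = \prod_(z <- zs) ('X - z%:P) ->
  (monic_poly_of g)^`() = n%:R *: \prod_(w <- ws) ('X - w%:P) ->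
  (count (root (monic_poly_of g)) ws + size (undup zs) = n)%N.
Proof.
move=> Dzs Dws; have : size zs = n.
  by apply: succn_inj; rewrite -(size_monic_poly_of g) Dzs size_prod_XsubC.
move=> szzs; rewrite -[RHS]szzs Dzs (eq_count (root_prod_XsubC zs)).
have -> : count (mem zs) ws = \sum_(x <- undup zs) count_mem x ws.
  exact: count_undup_sum.
have : count (mem zs) zs = size zs by apply/eqP; rewrite -all_count; apply/allP.
move=> <-; rewrite count_undup_sum -sum1_size -big_split /=.
rewrite !big_seq; apply: eq_bigr => x; rewrite mem_undup => xzs.
by rewrite (count_deriv_roots Dzs Dws xzs) addn1.
Qed.

(** Lower bound for the order: the roots of the derivative that are roots of the
    polynomial are, with multiplicity, the roots of a common divisor. *)
Lemma vanishes_discr g ws :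
  (monic_poly_of g)^`() = n%:R *: \prod_(w <- ws) ('X - w%:P) ->
  vanishes (count (root (monic_poly_of g)) ws) g D.
Proof.
move=> Dws; pose F := monic_poly_of g; have [zs Dzs] := monic_poly_of_roots g.
pose h := \prod_(w <- filter (root F) ws) ('X - w%:P).
have -> : count (root F) ws = (size h).-1.
  by rewrite size_prod_XsubC size_filter.
have evX : map_poly (meval g) (general_poly K n) = F.
  rewrite map_monic_poly_of /F; congr (monic_poly_of _).
  by apply/funext => i /=; rewrite mevalXU.
apply: vanishesMl; apply: vanishes_resultant; rewrite -?deriv_map evX.
- by rewrite -size_poly_eq0 size_deriv_monic_poly_of // -lt0n.
- have [|u pu] := @perm_cat_of_count_le _ (filter (root F) ws) zs.
    move=> x; rewrite count_filter; case: (boolP (x \in zs)) => xzs.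
      rewrite (count_deriv_roots Dzs Dws xzs) ltnW // ltnS.
      by apply: sub_count => y /= /andP[].
    rewrite (eq_count (a2 := pred0)) ?count_pred0 // => y /=.
    apply: contraNF xzs => /andP[/eqP -> ].
    by rewrite /F Dzs root_prod_XsubC.
  by rewrite /F Dzs (perm_big _ pu) big_cat dvdp_mulr.
by rewrite Dws dvdpZr // (bigID (root F)) /= -big_filter dvdp_mulr.
Qed.

Section VaryConstantTerm.
Context (g : 'I_n -> K) (ws : seq K).
Context (Dws : (monic_poly_of g)^`() = n%:R *: \prod_(w <- ws) ('X - w%:P)).
Let i0 : 'I_n := Ordinal n_gt0.
Let F := monic_poly_of g.
Let vs := [seq - F.[w] | w <- ws].

Lemma monic_poly_of_line t : monic_poly_of (line g i0 t) = F + t%:P.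
Proof.
apply/polyP => j; rewrite [RHS]coefD coefC !coef_monic_poly_of.
case: insubP => [i _ <-|]; last first.
  by rewrite -leqNgt => lenj; rewrite (gtn_eqF (leq_trans n_gt0 lenj)) addr0.
by rewrite /line -val_eqE /=; case: ifP; rewrite ?addr0.
Qed.

(** The roots of [F'] that are roots of [F + t] are those where [- F] takes the
    value [t]; hence the list [vs]. *)
Lemma vanishes_discr_line t : vanishes (count_mem t vs) (line g i0 t) D.
Proof.
have := @vanishes_discr (line g i0 t) ws.
rewrite monic_poly_of_line derivD derivC addr0.
move=> /(_ Dws); congr (vanishes _ _ _).
rewrite count_map; apply: eq_count => w /=.
by rewrite rootE hornerD hornerC addr_eq0 eqr_oppLR.
Qed.

Lemma size_deriv_roots : size ws = n.-1.
Proof.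
apply: succn_inj; rewrite prednK // -(size_deriv_monic_poly_of g n_neq0) Dws.
by rewrite size_scale // size_prod_XsubC.
Qed.

(** For [t] outside [vs], [F + t] and [F'] have no common root. *)
Lemma on_line_discr_neq0 : on_line g i0 D != 0.
Proof.
have : \prod_(v <- vs) ('X - v%:P) != 0 by rewrite monic_neq0 ?monic_prod_XsubC.
move=> /closed_nonrootP[t]; rewrite root_prod_XsubC => tvs.
apply: contraNneq tvs => P0.
have : D.@[line g i0 t] = 0 by rewrite -horner_on_line P0 horner0.
rewrite (map_discr (meval _)) //.
have -> : monic_poly_of (fun i => meval (line g i0 t) 'X_i) = F + t%:P.
  rewrite -monic_poly_of_line; congr (monic_poly_of _).
  by apply/funext => i /=; rewrite mevalXU.
move/eqP; rewrite mulf_eq0 signr_eq0 /= resultant_eq0 derivD derivC addr0.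
move=> sz; have [|x] := closed_rootP (gcdp (F + t%:P) F^`()) _.
  by rewrite gtn_eqF.
rewrite root_gcd => /andP[]; rewrite /F Dws rootZ // root_prod_XsubC -/F.
rewrite rootE hornerD hornerC addrC addr_eq0 => /eqP -> xws.
by apply/mapP; exists x.
Qed.

(** [t] enters [F + t] through the constant coefficient only, so it does not
    enter [F']. *)
Lemma size_on_line_discr : (size (on_line g i0 D) <= n)%N.
Proof.
have n0 : n%:R != 0 :> {poly K} by rewrite -polyC_natr polyC_eq0.
rewrite (map_discr (on_line g i0)) //.
set P := monic_poly_of _.
rewrite size_Msign.
have coefP j : (size (P`_j)%R <= 2)%N /\ ((0 < j)%N -> (size (P`_j)%R <= 1)%N).
  rewrite /P coef_monic_poly_of; case: insubP => [i _ Di|_]; last first.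
    have sz1 : (size ((j == n)%:R : {poly K}) <= 1)%N.
      by rewrite -polyC_natr size_polyC_leq1.
    by split=> //; apply: leq_trans sz1 _.
  rewrite /= on_lineX /line_pt -val_eqE /= Di; split=> [|j0].
    apply: leq_trans (size_polyD _ _) _; rewrite geq_max.
    rewrite (leq_trans (size_polyC_leq1 _)) //.
    by case: ifP; rewrite ?size_polyX ?size_poly0.
  by rewrite gtn_eqF // addr0 size_polyC_leq1.
apply: leq_trans (size_resultant_leq _ _) _.
- by move=> j; have [] := coefP j.
- move=> j; rewrite coef_deriv -mulr_natr -polyC_natr mulrC mul_polyC.
  by apply: leq_trans (size_scale_leq _ _) _; have [_ ->] := coefP j.+1.
by rewrite size_deriv_monic_poly_of // prednK.
Qed.

(** The multiplicities are bounded below by the counts in [vs], whose sum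
    [n - 1] is already the largest degree possible. *)
Lemma mup_on_line_discr t : mup t (on_line g i0 D) = count_mem t vs.
Proof.
have P0 := on_line_discr_neq0; set P := on_line g i0 D in P0 *.
have [ss Dss] := closed_field_poly_normal P.
have mupP x : mup x P = count_mem x ss.
  by rewrite {1}Dss mup_scale_prod_XsubC // lead_coef_eq0.
have [|u pu] := @perm_cat_of_count_le _ vs ss.
  move=> x; rewrite -mupP mup_geq // vanishes_on_line //.
  exact: vanishes_discr_line.
have szP : (size ss <= size vs)%N.
  rewrite size_map size_deriv_roots -ltnS prednK //.
  rewrite (leq_trans _ size_on_line_discr) //.
  by rewrite -/P {1}Dss size_scale ?lead_coef_eq0 // size_prod_XsubC.
have u0 : u = [::].
  apply/nilP; rewrite /nilp -leqn0 -(leq_add2l (size vs)) addn0 -size_cat.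
  by rewrite -(perm_size pu).
by rewrite mupP (seq.permP pu) u0 cats0.
Qed.

Lemma vanishes_discr_iff d :
  vanishes d g D <-> (d <= count (root F) ws)%N.
Proof.
split=> [Vd|le_d]; last exact: vanishes_leq le_d (vanishes_discr Dws).
have -> : count (root F) ws = mup 0 (on_line g i0 D).
  rewrite mup_on_line_discr count_map; apply: eq_count => w /=.
  by rewrite oppr_eq0.
rewrite mup_geq ?on_line_discr_neq0 //; apply: vanishes_on_line.
suff -> : line g i0 0 = g by [].
by apply/funext => i; rewrite /line if_same addr0.
Qed.
End VaryConstantTerm.

Lemma card_roots_vanishes g k :
  [set x : K | root (monic_poly_of g) x] #<= `I_k <-> vanishes (n - k) g D.
Proof.
have [zs Dzs] := monic_poly_of_roots g.
have [ws Dws] := deriv_monic_poly_of_roots g.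
have -> : [set x | root (monic_poly_of g) x] = [set x | x \in undup zs].
  by apply/seteqP; split=> x /=; rewrite Dzs root_prod_XsubC mem_undup.
rewrite (card_le_eql (card_mem_seq (undup_uniq zs))) card_le_II.
apply: iff_trans (iff_sym (vanishes_discr_iff Dws _)).
by rewrite leq_subLR -{1}(count_common_roots Dzs Dws) addnC leq_add2r.
Qed.
End Main.

(** * The stratification *)

Lemma exists_card_roots (K : numFieldType) n k : (0 < k <= n)%N ->
  exists g : 'I_n -> K, [set x : K | root (monic_poly_of g) x] #= `I_k.
Proof.
case/andP=> k0 le_kn; pose t : seq K := [seq i%:R | i <- iota 0 k].
pose zs := t ++ nseq (n - k) 0.
pose p := \prod_(z <- zs) ('X - z%:P).
exists (fun i => p`_i).
rewrite monic_poly_of_coefs ?monic_prod_XsubC //; last first.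
  by rewrite size_prod_XsubC size_cat size_map size_iota size_nseq subnKC.
have -> : [set x | root p x] = [set x | x \in t].
  have t0 : 0 \in t by apply/mapP; exists 0%N; rewrite // mem_iota.
  apply/seteqP; split=> x /=; rewrite root_prod_XsubC mem_cat.
    by case/orP => // /nseqP[-> _].
  by move=> ->.
rewrite -[k in `I_k](size_iota 0) -(size_map (fun i => i%:R : K)).
apply: card_mem_seq; rewrite map_inj_uniq ?iota_uniq //.
by apply: mulrIn; rewrite oner_eq0.
Qed.

Theorem theorem8 (R : realType) (n : nat) (hn : (1 <= n)%N) :
  [/\ (forall k : nat, (1 <= k <= n - 1)%N -> Zk R[i] n k = Ok R[i] n k),
      (forall k : nat, (1 <= k <= n - 1)%N ->
         Zk R[i] n k =
         zero_locus [set p | exists2 delta : 'X_{1..n},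
                      (mdeg delta <= n - k - 1)%N
                      & p = (discr R[i] n)^`M[delta]]),
      (forall k : nat, (1 <= k)%N -> (k + 1 <= n - 1)%N ->
         Zk R[i] n k `<` Zk R[i] n (k + 1)) &
      Zk R[i] n (n - 1) = zero_locus [set discr R[i] n]].
Proof.
have ZkE k g : Zk R[i] n k g <-> vanishes (n - k) g (discr R[i] n).
  exact: card_roots_vanishes.
split.
- move=> k _; apply/seteqP; split=> g; rewrite /Ok /=.
    by move=> /ZkE Vg; apply/ord_ge_vanishes.
  by move=> /ord_ge_vanishes Vg; apply/ZkE.
- move=> k /andP[k1 k2]; apply/seteqP; split=> g.
    move=> /ZkE Vg p [delta le_d ->]; apply: Vg.
    have : (0 < n - k)%N by lia.
    lia.
  move=> Zg; apply/ZkE => delta lt_d; apply: (Zg _); exists delta => //.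
  lia.
- move=> k k1 k2; split=> [g Zg|sub].
    by apply: card_le_trans Zg _; rewrite card_le_II leq_addr.
  have [|g cg] := @exists_card_roots R[i] n (k + 1); first lia.
  have : Zk R[i] n k g by apply: sub; rewrite /Zk /= (card_le_eql cg) card_lexx.
  by rewrite /Zk /= (card_le_eql cg) card_le_II addn1 ltnn.
- apply/seteqP; split=> g.
    by move=> /ZkE Vg p ->; rewrite -[discr _ _]mderivm0m Vg // mdeg0; lia.
  move=> Zg; apply/ZkE => delta lt_d.
  have /eqP : mdeg delta = 0%N by lia.
  by rewrite mdeg_eq0 => /eqP ->; rewrite mderivm0m; apply: Zg.
Qed.
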